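(* Let $\mathcal{M}=\{M_j\}_{j\in J}$ be a finite nonempty collection of monomials $M_j=x_0x_1^{a_{1,j}}\cdots x_n^{a_{n,j}}\in\mathbb{C}[x_0,\ldots,x_n]$ with $a_{i,j}\ge 1$ for every $i,j$. Assume that $\mathcal{M}$ is a $(1,1)$-free collection. For $\{j_1,\ldots,j_k\}\subseteq J$ let $M_{j_1,\ldots,j_k}=\gcd(M_{j_1},\ldots,M_{j_k})$. Then $$\mathrm{rk}_{\mathbb{C}}\,\mathcal{M}=\sum_{\emptyset\ne\{j_1,\ldots,j_k\}\subseteq J}(-1)^{k+1}\,\mathrm{rk}_{\mathbb{C}}\,M_{j_1,\ldots,j_k},$$ where the sum is over all nonempty subsets of $J$ and $k$ denotes the cardinality of the subset.
   Context: Here $n$ is a nonnegative integer, and a form is a homogeneous polynomial. For a finite collection of forms $\mathcal{F}=\{F_1,\ldots,F_s\}$ in $S=\mathbb{C}[x_0,\ldots,x_n]$ (degrees not necessarily equal), the simultaneous Waring rank $\mathrm{rk}_{\mathbb{C}}\,\mathcal{F}$ is the minimal integer $r$ such that there exist linear forms $L_1,\ldots,L_r\in S$ with the property that every $F_i$ can be written as $F_i=\sum_{j=1}^r\lambda_{i,j}L_j^{d_i}$ with $d_i=\deg F_i$ and $\lambda_{i,j}\in\mathbb{C}$. For a single form, $\mathrm{rk}_{\mathbb{C}}\,F=\mathrm{rk}_{\mathbb{C}}\{F\}$ is the usual complex Waring rank. $(1,1)$-free collections: let $\mathcal{M}=\{M_j\}_{j\in J}$ with $M_j=x_0x_1^{a_{1,j}}\cdots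 x_n^{a_{n,j}}$. For each $1\le i\le n$, order linearly the exponents of $x_i$ appearing in the monomials of $\mathcal{M}$ as $a_{i,k_1}\le a_{i,k_2}\le\cdots\le a_{i,k_{|J|}}$ (with repetitions), and let $\mathcal{D}_i$ be the multiset of differences $a_{i,k_{s+1}}-a_{i,k_s}$ of successive elements. The collection $\mathcal{M}$ is $(1,1)$-free if, for every $i\in\{1,\ldots,n\}$, the multiset $\mathcal{D}_i$ contains $1$ at most one time. *)

(* Defs.v *)
From mathcomp Require Import all_boot all_order all_algebra.
From mathcomp Require Import boolp classical_sets reals.
From mathcomp Require Import complex mpoly.

Set Implicit Arguments.
Unset Strict Implicit.
Unset Printing Implicit Defensive.

Import GRing.Theory.

Local Open Scope ring_scope.

Section WaringRank.
Variables (K : fieldType) (n : nat) (I : finType).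
Implicit Types (F : I -> {mpoly K[n]}) (r : nat).

(* [msize p] is one more than the total degree of a nonzero [p], so
   [(msize (F i)).-1] is the degree of the form [F i]. *)
Definition simul_waring_decomp F r : Prop :=
  exists L : 'I_r -> {mpoly K[n]},
    (forall j, L j \is 1.-homog) /\
    forall i, exists lambda : 'I_r -> K,
      F i = \sum_(j < r) lambda j *: L j ^+ (msize (F i)).-1.

Definition is_simul_waring_rank F r : Prop :=
  simul_waring_decomp F r /\
  forall r', simul_waring_decomp F r' -> (r <= r')%N.

(* The default value 0 is only taken when no decomposition exists; in
   characteristic 0 every finite family of forms has one. *)
Definition simul_waring_rank F : nat :=
  xget 0%N [set r | is_simul_waring_rank F r]%classic.

End WaringRank.

Definition waring_rank (K : fieldType) (n : nat) (F : {mpoly K[n]}) : nat :=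
  simul_waring_rank (fun _ : unit => F).

Section Gcd.
Variables (K : fieldType) (n : nat).
Implicit Types p q d : {mpoly K[n]}.

Definition mpoly_dvd p q : Prop := exists c, q = c * p.

(* Greatest common divisors are determined up to a nonzero constant. *)
Definition is_mpoly_gcd (J : finType) (A : {set J}) (F : J -> {mpoly K[n]}) d :
    Prop :=
  (forall j, j \in A -> mpoly_dvd d (F j)) /\
  forall e, (forall j, j \in A -> mpoly_dvd e (F j)) -> mpoly_dvd e d.

End Gcd.

(* The monomial x_0 x_1^{a_1} ... x_n^{a_n}; the index [i : 'I_n] of an
   exponent stands for the variable x_{i+1}. *)
Definition x0_monomial (K : fieldType) (n : nat) (a : 'I_n -> nat) :
    {mpoly K[n.+1]} :=
  'X_ord0 * \prod_(i < n) 'X_(lift ord0 i) ^+ a i.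

Definition successive_differences (s : seq nat) : seq nat :=
  let t := sort leq s in
  [seq (nth 0 t k.+1 - nth 0 t k)%N | k <- iota 0 (size t).-1].

Definition one_one_free (n : nat) (J : finType) (a : J -> 'I_n -> nat) : Prop :=
  forall i : 'I_n,
    (count_mem 1 (successive_differences [seq a j i | j <- enum J]) <= 1)%N.

(* Main.v *)
(* Both sides count the lattice points of the union U of the boxes
   {b | b_i <= a_{j,i} for all i}, j in J: on the right this is inclusion-exclusion,
   since the exponents of a gcd are pointwise minima.

   Lower bound. A decomposition of M_j by powers of linear forms l_k makes
   g |-> sum_k lambda_k g(l_k), on forms g of degree deg M_j, a nonzero multiple of
   the coefficient of g at M_j. If a combination p of the dehomogenized monomials
   x^b, b in U, vanished at all l_k with nonzero x_0-coordinate, choose b0 of maximal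
   degree d in its support and j whose box contains b0: the form x_0 p^h x^(a_j - b0)
   has degree deg M_j, vanishes at all l_k, and has nonzero coefficient at M_j, a
   contradiction. So U indexes linearly independent functions on the l_k.

   Upper bound. For each variable x_i, (1,1)-freeness yields distinct numbers
   z_0, z_1, ... with z_0 + ... + z_e = 0 for every exponent e of x_i in the
   collection. The forms x_0 + sum_i z_{i,b_i} x_i, b in U, work: weighting those with b
   in the j-th box by products of divided-difference weights kills every coefficient of
   the power sum in degree deg M_j except the one at M_j. *)
Require Import Defs.
From mathcomp Require Import all_boot all_order all_algebra.
From mathcomp Require classical_sets.
From mathcomp Require Import reals complex mpoly.
From mathcomp Require Import zify ring.

Set Implicit Arguments.
Unset Strict Implicit.
Unset Printing Implicit Defensive.

Import Order.TTheory GRing.Theory Num.Theory.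
Local Open Scope ring_scope.

(** * Inclusion-exclusion for finite sets *)

(** Checked point by point: the product over j of 1 - [x in B_j] is the indicator of the complement
    of the union, and its expansion over subsets of [J] has the term 1 at the empty subset. *)
Lemma card_bigcup_inclusion_exclusion (T J : finType) (B : J -> {set T}) :
  #|\bigcup_j B j|%:Z =
  \sum_(A : {set J} | A != set0)
     (-1) ^+ (#|A|).+1 * #|\bigcap_(j in A) B j|%:Z :> int.
Proof.
have cardE (X : {set T}) : #|X|%:Z = \sum_x ((x \in X)%:R : int).
  rewrite -sum1_card -natz natr_sum big_mkcond.
  by apply: eq_bigr => x _; case: (x \in X).
rewrite cardE.
transitivity (\sum_x \sum_(A : {set J} | A != set0)
    (-1) ^+ (#|A|).+1 * ((x \in \bigcap_(j in A) B j)%:R : int)); last first.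
  by rewrite exchange_big; apply: eq_bigr => A _; rewrite cardE mulr_sumr.
apply: eq_bigr => x _.
have prodE (A : {set J}) :
    (x \in \bigcap_(j in A) B j)%:R = \prod_(j in A) ((x \in B j)%:R : int).
  case: bigcapP => [xA|xA].
    by rewrite big1 // => j jA; rewrite xA.
  apply/esym/eqP; rewrite prodf_seq_eq0; apply/hasP.
  case: (boolP [exists j in A, x \notin B j]) => [/exists_inP[j jA xj]|].
    by exists j; rewrite ?mem_index_enum // jA (negbTE xj) eqxx.
  rewrite negb_exists => /forallP h; case: xA => j jA.
  by move: (h j); rewrite jA /= negbK.
have h : \prod_j (- (x \in B j)%:R + 1) =
    \sum_(A : {set J}) \prod_j (if j \in A then - (x \in B j)%:R else 1) :> int.
  by rewrite bigA_distr.
rewrite (bigD1 (set0 : {set J})) //= [X in _ = X + _]big1 in h; last first.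
  by move=> j _; rewrite inE.
have unionE : (x \in \bigcup_j B j)%:R = 1 - \prod_j (- (x \in B j)%:R + 1) :> int.
  case: bigcupP => [[j _ xj]|xB].
    by rewrite (bigD1 j) //= xj addNr mul0r subr0.
  rewrite big1 ?subrr // => j _; case: (boolP (x \in B j)) => xj.
    by case: xB; exists j.
  by rewrite oppr0 add0r.
rewrite unionE h opprD addNKr -sumrN; apply: eq_bigr => A _.
rewrite prodE exprS mulN1r mulNr -big_mkcond /=; congr (- _).
by rewrite prodrN.
Qed.

(** * Coefficients of powers of linear forms *)

Section MultinomialPowers.
Variables (K : numFieldType) (n : nat).
Implicit Types (m : 'X_{1..n}) (l : 'I_n -> K).

Definition linear_form l : {mpoly K[n]} := \sum_i l i *: 'X_i.

(** The multinomial coefficient, as the number of words in the variables with exponent vector [m];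
    these words are the terms that appear when a power of a sum is distributed. *)
Definition multinomial m : nat :=
  #|[set f : {ffun 'I_(mdeg m) -> 'I_n} | (\sum_k U_(f k))%MM == m]|.

Lemma linear_form_homog l : linear_form l \is 1.-homog.
Proof.
by apply: rpred_sum => i _; apply/dhomogZ; rewrite dhomogX; apply/eqP/mdeg1.
Qed.

Lemma homog1_linear_form (L : {mpoly K[n]}) :
  L \is 1.-homog -> L = linear_form (fun i => L@_U_(i)).
Proof.
move=> L1; apply/mpolyP => m; rewrite /linear_form raddf_sum /=.
under eq_bigr do rewrite mcoeffZ mcoeffX.
have [/eqP/mdeg1P[i /eqP->]|mN1] := eqVneq (mdeg m) 1%N.
  rewrite (bigD1 i) //= eqxx mulr1 big1 ?addr0 // => j ji.
  suff /negbTE-> : U_(j)%MM != U_(i)%MM by rewrite mulr0.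
  by apply: contra ji => /eqP/mnmP/(_ i); rewrite !mnm1E eqxx; case: eqP.
rewrite (dhomog_nemf_coeff L1 mN1) big1 // => i _.
by case: eqP => [mE|]; rewrite ?mulr0 //; rewrite -mE mdeg1 in mN1.
Qed.

Lemma mcoeff_linear_formX l m :
  (linear_form l ^+ mdeg m)@_m = (multinomial m)%:R * \prod_i l i ^+ m i.
Proof.
rewrite /linear_form -[X in _ ^+ X]card_ord -prodr_const bigA_distr_bigA.
rewrite raddf_sum /= /multinomial -sum1_card natr_sum mulr_suml [RHS]big_mkcond /=.
apply: eq_bigr => f _; rewrite scaler_prod mcoeffZ mprodXE mcoeffX inE.
case: eqP => [mE|]; last by rewrite mulr0.
rewrite mulr1 mul1r.
under [RHS]eq_bigr => i _.
  rewrite -{1}mE mnm_sumE -prodrXr.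
  over.
rewrite exchange_big /=; apply: eq_bigr => k _.
rewrite (bigD1 (f k)) //= mnm1E eqxx expr1 big1 ?mulr1 // => i.
by rewrite eq_sym mnm1E => /negbTE->.
Qed.

Lemma multinomial_gt0 m : (0 < multinomial m)%N.
Proof.
suff [f mE] : exists f : {ffun 'I_(mdeg m) -> 'I_n}, (\sum_k U_(f k))%MM = m.
  by apply/card_gt0P; exists f; rewrite inE mE.
move: {-1}(mdeg m) (erefl (mdeg m)) => d.
elim: d m => [|d IHd] m md.
  have f0 : 'I_0 -> 'I_n by case.
  exists [ffun k => f0 k]; rewrite big_ord0.
  by apply/esym/eqP; rewrite -mdeg_eq0 md.
have [i mi] : exists i, m i != 0%N.
  apply/existsP; rewrite -negb_forall; apply/negP => /forallP m0.
  by move: md; rewrite mdegE big1 // => i _; apply/eqP.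
have mE : (m - U_(i) + U_(i))%MM = m.
  rewrite submK //; apply/mnm_lepP => j; rewrite mnm1E.
  by case: eqP => [<-|//]; rewrite lt0n.
have [f fE] : exists f : {ffun 'I_d -> 'I_n}, (\sum_k U_(f k))%MM = (m - U_(i))%MM.
  by apply: IHd; move: md; rewrite -{1}mE mdegD mdeg1 addn1 => -[].
exists [ffun k => oapp f i (unlift ord_max k)].
rewrite big_ord_recr /= ffunE unlift_none /= -[RHS]mE -fE; congr (_ + _)%MM.
apply: eq_bigr => k _; rewrite ffunE.
suff -> : widen_ord (leqnSn d) k = lift ord_max k by rewrite liftK.
by apply: val_inj; rewrite /= /bump leqNgt ltn_ord.
Qed.

Lemma multinomial_neq0 m : (multinomial m)%:R != 0 :> K.
Proof. by rewrite pnatr_eq0 -lt0n multinomial_gt0. Qed.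

(** Compares coefficients; outside degree [mdeg m] both sides vanish by homogeneity. The lower bound
    extracts these moment equations from a decomposition, the upper bound builds a decomposition by
    solving them. *)
Lemma mpolyX_linear_powersP (I : finType) (l : I -> 'I_n -> K) (c : I -> K) m :
  'X_[m] = \sum_k c k *: linear_form (l k) ^+ mdeg m <->
  forall m', mdeg m' = mdeg m ->
    (multinomial m')%:R * \sum_k c k * \prod_i l k i ^+ m' i = (m == m')%:R.
Proof.
have coefE m' : mdeg m' = mdeg m ->
    (\sum_k c k *: linear_form (l k) ^+ mdeg m)@_m' =
    (multinomial m')%:R * \sum_k c k * \prod_i l k i ^+ m' i.
  move=> <-; rewrite raddf_sum mulr_sumr; apply: eq_bigr => k _ /=.
  by rewrite mcoeffZ mcoeff_linear_formX mulrCA.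
split=> [h m' m'd|h]; first by rewrite -coefE // -h mcoeffX.
apply/mpolyP => m'; have [m'd|m'd] := eqVneq (mdeg m') (mdeg m).
  by rewrite mcoeffX coefE // h.
rewrite mcoeffX; case: eqP => [mm'|_]; first by rewrite mm' eqxx in m'd.
apply/esym; apply: dhomog_nemf_coeff m'd; apply: rpred_sum => k _.
apply: dhomogZ; rewrite -[X in X.-homog]mul1n.
exact/dhomogMn/linear_form_homog.
Qed.

End MultinomialPowers.

(** * Interpolation weights, and nodes with prescribed zero sums *)

(** The weights form the last column of the inverse Vandermonde matrix, that is, the divided
    difference at the d+1 nodes. On the power d+1 it returns the sum of the nodes, which is zero by
    assumption. *)
Lemma divided_difference_weights (K : fieldType) (d : nat) (z : nat -> K) :
  injective z -> \sum_(t < d.+1) z t = 0 ->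
  exists w : nat -> K,
    [/\ forall k, (k < d)%N -> \sum_(t < d.+1) w t * z t ^+ k = 0,
        \sum_(t < d.+1) w t * z t ^+ d = 1 &
        \sum_(t < d.+1) w t * z t ^+ d.+1 = 0].
Proof.
move=> z_inj z_sum.
pose V := Vandermonde d.+1 (\row_(t < d.+1) z t).
have V_unit : V \in unitmx.
  rewrite unitmxE unitfE det_Vandermonde; apply/prodf_neq0 => i _.
  apply/prodf_neq0 => j ij; rewrite !mxE subr_eq0.
  by apply: contraTneq ij => /z_inj->; rewrite ltnn.
pose w : 'cV_d.+1 := invmx V *m delta_mx ord_max 0.
have wE (k : 'I_d.+1) : \sum_(t < d.+1) w t 0 * z t ^+ k = (k == ord_max)%:R.
  have := congr1 (fun A : 'cV_d.+1 => A k 0) (mulKVmx V_unit (delta_mx ord_max 0)).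
  rewrite [LHS]mxE [RHS]mxE eqxx andbT => <-.
  by apply: eq_bigr => t _; rewrite !mxE mulrC.
(* The values of [inord] beyond [d] are arbitrary and never enter the sums. *)
exists (fun t => w (inord t) 0).
have sumE k : \sum_(t < d.+1) w (inord t) 0 * z t ^+ k = \sum_(t < d.+1) w t 0 * z t ^+ k.
  by apply: eq_bigr => t _; rewrite inord_val.
have wd (k : nat) : (k < d.+1)%N -> \sum_(t < d.+1) w t 0 * z t ^+ k = (k == d)%:R.
  by move=> kd; rewrite (wE (Ordinal kd)).
split=> [k kd||]; rewrite sumE.
- by rewrite wd ?ltn_eqF // leqW.
- by rewrite wd // eqxx.
(* [z t] is a root of [P], whose coefficient of degree [d] is minus the sum of
   the roots: this trades [z t ^+ d.+1] for lower powers. *)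
pose P := \prod_(x <- [seq z t | t : 'I_d.+1]) ('X - x%:P).
have sizeP : size [seq z t | t : 'I_d.+1] = d.+1 by rewrite size_image card_ord.
have Pd : P`_d = 0.
  have := @coefPn_prod_XsubC _ [seq z t | t : 'I_d.+1].
  by rewrite sizeP => ->//; rewrite big_image /= z_sum oppr0.
have Pd1 : P`_d.+1 = 1.
  have /monicP := monic_prod_XsubC [seq z t | t : 'I_d.+1] xpredT id.
  by rewrite lead_coefE size_prod_XsubC sizeP.
have Proot (t : 'I_d.+1) : z t ^+ d.+1 = - \sum_(k < d.+1) P`_k * z t ^+ k.
  have /eqP : P.[z t] = 0.
    by apply/eqP; rewrite -/(root P (z t)) root_prod_XsubC image_f.
  rewrite horner_coef size_prod_XsubC sizeP big_ord_recr /= Pd1 mul1r.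
  by rewrite addrC addr_eq0 => /eqP.
under eq_bigr do rewrite Proot mulrN mulr_sumr.
rewrite sumrN exchange_big big1 ?oppr0 // => k _.
under eq_bigr do rewrite mulrCA.
rewrite -mulr_sumr wE; case: eqP => [->|_]; last by rewrite mulr0.
by rewrite Pd mul0r.
Qed.

(** Two consecutive vanishing partial sums force a zero term, and injectivity leaves room for one
    zero only. The empty sum vanishes as well, so [~~ E 0] keeps it from producing another. *)
Lemma exists_injective_zero_sums (K : numFieldType) (E : pred nat) :
  ~~ E 0%N -> (forall e f, E e -> E e.+1 -> E f -> E f.+1 -> e = f) ->
  exists z : nat -> K,
    injective z /\ forall e, E e -> \sum_(t < e.+1) z t = 0.
Proof.
move=> E0 E_free.
(* [P t] marks the lengths [t] at which the partial sum must vanish; an exponent [e] corresponds to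
   length [e.+1]. *)
pose P t := (t == 0%N) || E t.-1.
(* Partial sums vanishing exactly at the prescribed places; each term is then
   [2 * 3 ^ t], [3 ^ t.+1], [- 3 ^ t] or [0], the last one at most once. *)
pose S t : int := if P t then 0 else 3 ^+ t.
pose z t := S t.+1 - S t.
have sum_z m : \sum_(t < m) z t = S m.
  elim: m => [|m IHm]; first by rewrite big_ord0.
  by rewrite big_ord_recr /= IHm /z addrC subrK.
have P1 t : P t -> P t.+1 -> E t /\ E t.-1.
  by rewrite /P /=; case: t => [|t] /=; [rewrite (negbTE E0)|].
have P_free t u : P t -> P t.+1 -> P u -> P u.+1 -> t = u.
  move=> /P1 h /h{h}[Et Et1] /P1 h /h{h}[Eu Eu1].
  case: t u Et Et1 Eu Eu1 => [|t] [|u] /=; rewrite ?(negbTE E0) //.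
  by move=> Et Et1 Eu Eu1; congr _.+1; apply: E_free.
have exp_inj (t u : nat) : (3 : int) ^+ t = 3 ^+ u -> t = u.
  exact: ieexprIn.
(* Parity tells [3 ^ t.+1] from [2 * 3 ^ u]; signs separate the remaining kinds of terms. *)
have odd_exp t : exists q : int, 3 ^+ t = 2 * q + 1.
  elim: t => [|t [q qE]]; first by exists 0.
  by exists (3 * q + 1); rewrite exprS qE; ring.
have z_inj : injective z.
  move=> t u; rewrite /z /S.
  have t_gt0 : 0 < (3 : int) ^+ t by rewrite exprn_gt0.
  have u_gt0 : 0 < (3 : int) ^+ u by rewrite exprn_gt0.
  case Pt1: (P t.+1); case Pt: (P t); case Pu1: (P u.+1); case Pu: (P u);
    rewrite ?exprS; try lia.
  - by move=> _; apply: P_free.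
  - by move=> h; apply: exp_inj; lia.
  - by move=> h; apply: exp_inj; lia.
  - by have [q] := odd_exp t; have [q'] := odd_exp u; lia.
  - by have [q] := odd_exp t; have [q'] := odd_exp u; lia.
  - by move=> h; apply: exp_inj; lia.
exists (fun t => (z t)%:~R); split=> [t u /intr_inj/z_inj //|e Ee].
by rewrite -rmorph_sum /= sum_z /S /P /= Ee.
Qed.

(** Each pair x, x+1 of values yields a difference 1 at some position of the sorted list, and
    different pairs yield different positions. *)
Lemma one_one_free_consecutive (s : seq nat) (e f : nat) :
  (count_mem 1%N (successive_differences s) <= 1)%N ->
  e \in s -> e.+1 \in s -> f \in s -> f.+1 \in s -> e = f.
Proof.
rewrite /successive_differences; set t := sort leq s => cnt es e1s fs f1s.
have st : sorted leq t by apply: sort_sorted => x y; apply: leq_total.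
have mt x : (x \in t) = (x \in s) by rewrite mem_sort.
have nth_leq i j : (i <= j)%N -> (j < size t)%N -> (nth 0 t i <= nth 0 t j)%N.
  move=> ij jt; apply: (sorted_leq_nth leq_trans leqnn) => //.
  by rewrite inE (leq_ltn_trans ij).
have gapP x : x \in s -> x.+1 \in s ->
    exists k, [/\ (k.+1 < size t)%N, nth 0%N t k = x & nth 0%N t k.+1 = x.+1].
  (* The entry just before the first occurrence of x+1 is at least x, which occurs earlier, and is
     not x+1, hence equals x. *)
  rewrite -!mt => xs x1s; set i := index x.+1 t; set j := index x t.
  have it : (i < size t)%N by rewrite index_mem.
  have jt : (j < size t)%N by rewrite index_mem.
  have ti : nth 0%N t i = x.+1 by rewrite nth_index.
  have tj : nth 0%N t j = x by rewrite nth_index.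
  have ji : (j < i)%N.
    by rewrite ltnNge; apply/negP => /nth_leq/(_ jt); rewrite ti tj ltnn.
  case iE: i ji => [//|k]; rewrite ltnS => jk.
  exists k; rewrite -iE; split=> //; apply/eqP; rewrite eqn_leq.
  have kt : (k < size t)%N by rewrite ltnW // -iE.
  rewrite -{2}tj nth_leq // andbT -ltnS ltn_neqAle -ti nth_leq -?ti ?andbT //; last first.
    by rewrite iE.
  apply/negP => /eqP tk.
  have := @before_find _ 0%N (pred1 x.+1) t k; rewrite -/(index x.+1 t) -/i iE ltnS.
  by move=> /(_ (leqnn _)) /=; rewrite tk ti eqxx.
have [k [kt tk tk1]] := gapP _ es e1s.
have [l [lt tl tl1]] := gapP _ fs f1s.
rewrite -tk -tl; congr nth; apply/eqP; apply: contraLR cnt => kl.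
rewrite -ltnNge count_map -size_filter.
rewrite (@uniq_leq_size _ [:: k; l]) //= ?inE ?kl // => x.
rewrite !inE mem_filter /= mem_iota /= add0n.
by case/orP=> /eqP->; rewrite ?tk ?tk1 ?tl ?tl1 subSnn eqxx /= -ltnS prednK //;
  apply: leq_ltn_trans kt || apply: leq_ltn_trans lt.
Qed.

(** * Exponent vectors split at the zeroth variable, and scaling of decompositions *)

Section ZerothVariable.
Variable n : nat.
Implicit Types (a : 'I_n -> nat) (q : nat).

Definition cons_mnm q a : 'X_{1..n.+1} :=
  [multinom oapp a q (unlift ord0 i) | i < n.+1].

Lemma cons_mnm0 q a : cons_mnm q a ord0 = q.
Proof. by rewrite mnmE unlift_none. Qed.

Lemma cons_mnm_lift q a i : cons_mnm q a (lift ord0 i) = a i.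
Proof. by rewrite mnmE liftK. Qed.

Lemma mdeg_cons_mnm q a : mdeg (cons_mnm q a) = (q + \sum_i a i)%N.
Proof.
rewrite mdegE big_ord_recl cons_mnm0; congr (_ + _)%N.
by apply: eq_bigr => i _; rewrite cons_mnm_lift.
Qed.

Lemma x0_monomialE (K : fieldType) a : x0_monomial K a = 'X_[cons_mnm 1 a].
Proof.
rewrite mpolyXE_id big_ord_recl cons_mnm0 expr1; congr (_ * _).
by apply: eq_bigr => i _; rewrite cons_mnm_lift.
Qed.

Lemma degree_x0_monomial (K : fieldType) a :
  (msize (x0_monomial K a)).-1 = mdeg (cons_mnm 1 a).
Proof. by rewrite x0_monomialE msizeX. Qed.

End ZerothVariable.

(** Needed because a gcd is fixed only up to a nonzero constant; such constants preserve degrees and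
    are absorbed by the coefficients. *)
Lemma simul_waring_decompZ (K : fieldType) (n r : nat) (I : finType)
    (c : I -> K) (F : I -> {mpoly K[n]}) :
  (forall i, c i != 0) ->
  simul_waring_decomp F r -> simul_waring_decomp (fun i => c i *: F i) r.
Proof.
move=> c0 [L [L1 FL]]; exists L; split=> // i.
have [lam FE] := FL i; exists (fun k => c i * lam k).
rewrite msizeZ // {1}FE scaler_sumr; apply: eq_bigr => k _.
by rewrite scalerA.
Qed.

Lemma simul_waring_rank_eq (K : fieldType) (n r : nat) (I : finType)
    (F : I -> {mpoly K[n]}) :
  is_simul_waring_rank F r -> simul_waring_rank F = r.
Proof.
move=> Fr; apply: classical_sets.xget_unique => // s [Fs s_min].
by apply/eqP; rewrite eqn_leq (s_min _ Fr.1) (Fr.2 _ Fs).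
Qed.

(** * Lower and upper bounds by lattice points in boxes *)

Section Boxes.
Variables (K : numFieldType) (n N : nat) (J : finType) (a : J -> 'I_n -> nat).

(** [N] makes the ambient type finite; once it exceeds all exponents, no lattice point of the box is
    cut off. *)
Definition box (e : 'I_n -> nat) : {set {ffun 'I_n -> 'I_N}} :=
  [set b : {ffun 'I_n -> 'I_N} | [forall i, (b i <= e i)%N]].

Lemma card_boxes_le_simul_waring_decomp r :
  simul_waring_decomp (fun j => x0_monomial K (a j)) r ->
  (#|\bigcup_j box (a j)| <= r)%N.
Proof.
case=> L [L1 decomp]; set U := \bigcup_j box (a j).
pose l k i := (L k)@_U_(i).
have coef j : exists c : 'I_r -> K, forall m, mdeg m = mdeg (cons_mnm 1 (a j)) ->
    (multinomial m)%:R * \sum_k c k * \prod_i l k i ^+ m i =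
    (cons_mnm 1 (a j) == m)%:R.
  have [c cE] := decomp j; exists c; apply/mpolyX_linear_powersP.
  rewrite -(degree_x0_monomial K) -x0_monomialE {1}cE; apply: eq_bigr => k _.
  by rewrite {1}(homog1_linear_form (L1 k)).
pose deg (b : {ffun 'I_n -> 'I_N}) := (\sum_i b i)%N.
(* [ev h b k] below is the value at the k-th form of x^b made homogeneous of degree [h] by x_0. As
   [H] exceeds every [deg b], no subtraction truncates at [h = H]. *)
pose H := (\sum_(i < n) N).+1.
have degH b : (deg b < H)%N by rewrite ltnS leq_sum // => i _; apply: ltnW.
pose ev h b k := l k ord0 ^+ (h - deg b) * \prod_i l k (lift ord0 i) ^+ b i.
pose A := \matrix_(s < #|U|, k < r) ev H (enum_val s) k.
suff /eqP <- : row_free A by apply: rank_leq_col.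
apply: inj_row_free => v vA; apply/rowP => s1; rewrite !mxE; apply/eqP.
apply: contraT => vs1.
have [s0 vs0 s0_max] := @arg_maxnP _ s1 (fun s => v 0 s != 0)
  (fun s => deg (enum_val s)) vs1.
set d := deg (enum_val s0) in s0_max.
have deg_le s : v 0 s != 0 -> (deg (enum_val s) <= d)%N by move/s0_max.
(* The relation passes from degree [H] to [d.+1]: a nonzero x_0-coordinate lets the surplus power be
   cancelled, and at a zero one each term of the support still carries a factor x_0. *)
have ev_sum k : \sum_s v 0 s * ev d.+1 (enum_val s) k = 0.
  have [l0|l0] := eqVneq (l k ord0) 0.
    apply: big1 => s _; have [->|vs] := eqVneq (v 0 s) 0; first by rewrite mul0r.
    by rewrite /ev l0 expr0n subn_eq0 leqNgt ltnS deg_le // !(mul0r, mulr0).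
  apply: (mulfI (expf_neq0 (H - d.+1) l0)); rewrite mulr0.
  have := congr1 (fun B : 'rV_r => B 0 k) vA; rewrite !mxE => sum0; rewrite -[RHS]sum0.
  rewrite mulr_sumr; apply: eq_bigr => s _; rewrite mxE.
  have [->|vs] := eqVneq (v 0 s) 0; first by rewrite !mul0r mulr0.
  rewrite mulrCA /ev; congr (_ * _); rewrite mulrA -exprD; congr (_ ^+ _ * _).
  by have := deg_le _ vs; have := degH (enum_val s0); rewrite -/d; lia.
have /bigcupP[j _] := enum_valP s0; rewrite inE => /forallP b0_le.
have [c cE] := coef j.
(* Exponents of the s-th term of x_0 p^h x^(a_j - b0); using [d.+1] instead of [d] accounts for the
   leading x_0. *)
pose m (s : 'I_#|U|) := cons_mnm (d.+1 - deg (enum_val s))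
  (fun i => enum_val s i + (a j i - enum_val s0 i))%N.
have m_deg s : v 0 s != 0 -> mdeg (m s) = mdeg (cons_mnm 1 (a j)).
  move=> /deg_le sd; rewrite !mdeg_cons_mnm big_split /= -/(deg _).
  have -> : (\sum_i (a j i - enum_val s0 i) = \sum_i a j i - d)%N.
    rewrite sumnB // => i _.
  have : (d <= \sum_i a j i)%N by apply: leq_sum.
  by move=> dS; rewrite addnA subnK ?(leqW sd) // addSn subnKC // add1n.
have m_eq s : cons_mnm 1 (a j) = m s -> s = s0.
  move=> /mnmP ms; apply: enum_val_inj; apply/ffunP => i; apply: val_inj.
  have := ms (lift ord0 i); rewrite !cons_mnm_lift.
  by have := b0_le i => /=; lia.
have m0_eq : cons_mnm 1 (a j) = m s0.
  apply/mnmP => i; rewrite /m -/d subSnn; case: (unliftP ord0 i) => [k|] ->.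
    by rewrite !cons_mnm_lift subnKC.
  by rewrite !cons_mnm0.
pose C s := \sum_k c k * \prod_i l k i ^+ m s i.
have : \sum_s v 0 s * C s = 0.
  rewrite /C; under eq_bigr do rewrite mulr_sumr.
  rewrite exchange_big big1 // => k _.
  rewrite -[RHS](mulr0 (c k * \prod_i l k (lift ord0 i) ^+ (a j i - enum_val s0 i))).
  rewrite -[in RHS](ev_sum k) mulr_sumr; apply: eq_bigr => s _.
  rewrite big_ord_recl cons_mnm0 /ev.
  under [in LHS]eq_bigr => i _ do rewrite cons_mnm_lift exprD.
  rewrite big_split /=.
  have mulrACA5 (x y t u w : K) : x * (y * (t * (u * w))) = y * w * (x * (t * u)).
    by ring.
  exact: mulrACA5.
rewrite (bigD1 s0) //= big1 ?addr0 => [/eqP|s ss0].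
  rewrite mulf_eq0 (negbTE vs0) /= => /eqP sum0.
  have := cE (m s0) (m_deg _ vs0); rewrite -/(C s0) sum0 mulr0 m0_eq eqxx => /eqP.
  by rewrite eq_sym oner_eq0.
have [->|vs] := eqVneq (v 0 s) 0; first by rewrite mul0r.
have := cE (m s) (m_deg _ vs); rewrite -/(C s).
case: eqP => [/m_eq ss|_ /eqP]; first by rewrite ss eqxx in ss0.
by rewrite mulf_eq0 (negbTE (multinomial_neq0 _ _)) /= => /eqP->; rewrite mulr0.
Qed.

Lemma simul_waring_decomp_boxes :
  (forall j i, (1 <= a j i < N)%N) -> one_one_free a ->
  simul_waring_decomp (fun j => x0_monomial K (a j)) #|\bigcup_j box (a j)|.
Proof.
move=> a_bnd a_free; set U := \bigcup_j box (a j).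
have [i|z zP] := @fin_all_exists _ _ (fun i (z : nat -> K) => injective z /\
    forall j, \sum_(t < (a j i).+1) z t = 0).
  have [||z [z_inj z_sum]] := @exists_injective_zero_sums K
    [pred e | e \in [seq a j i | j <- enum J]].
  - by apply/negP => /mapP[j _ a0]; have := a_bnd j i; rewrite -a0.
  - by move=> e f; apply: one_one_free_consecutive.
  exists z; split=> // j; apply: z_sum.
  by apply/mapP; exists j; rewrite ?mem_enum.
pose p (b : {ffun 'I_n -> 'I_N}) i :=
  oapp (fun k => z k (b k)) 1 (unlift ord0 i).
exists (fun s => linear_form (p (enum_val s))); split=> [s|j].
  exact: linear_form_homog.
(* The weights depend on [j], whereas the nodes [z], and so the linear forms, serve the whole
   collection. *)
have [i|w wP] := @fin_all_exists _ _ (fun i (w : nat -> K) =>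
    [/\ forall k, (k < a j i)%N -> \sum_(t < (a j i).+1) w t * z i t ^+ k = 0,
        \sum_(t < (a j i).+1) w t * z i t ^+ a j i = 1 &
        \sum_(t < (a j i).+1) w t * z i t ^+ (a j i).+1 = 0]).
  by have [z_inj /(_ j) z_sum] := zP i; apply: divided_difference_weights.
set m := cons_mnm 1 (a j).
exists (fun s => (multinomial m)%:R^-1 *
  (if enum_val s \in box (a j) then \prod_i w i (enum_val s i) else 0)).
rewrite degree_x0_monomial x0_monomialE; apply/mpolyX_linear_powersP => m' m'd.
have sumE : \sum_(s < #|U|) (multinomial m)%:R^-1 *
      (if enum_val s \in box (a j) then \prod_i w i (enum_val s i) else 0) *
      \prod_i p (enum_val s) i ^+ m' i =
    (multinomial m)%:R^-1 *
      \prod_i \sum_(t < (a j i).+1) w i t * z i t ^+ m' (lift ord0 i).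
  rewrite -(big_enum_val (fun b => (multinomial m)%:R^-1 *
    (if b \in box (a j) then \prod_i w i (b i) else 0) *
    \prod_i p b i ^+ m' i)) /=.
  under eq_bigr do rewrite -mulrA.
  rewrite -mulr_sumr; congr (_ * _).
  under [RHS]eq_bigr => i _.
    rewrite (big_ord_widen N (fun t => w i t * z i t ^+ m' (lift ord0 i))); last first.
      by case/andP: (a_bnd j i).
    over.
  (* The product of one-variable sums expands over the functions bounded by the exponents, which are
     the points of the box. *)
  rewrite bigA_distr_big_dep.
  rewrite [LHS]big_mkcond [RHS]big_mkcond; apply: eq_bigr => b _.
  have -> : (b \in family (fun i => [pred t : 'I_N | (t < (a j i).+1)%N])) =
      (b \in box (a j)).
    by rewrite [RHS]inE; apply/familyP/forallP => bP i; have := bP i; rewrite ?inE.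
  have [bj|_] := boolP (b \in box (a j)); last by rewrite mul0r if_same.
  have -> : b \in U by apply/bigcupP; exists j.
  rewrite big_ord_recl {1}/p unlift_none expr1n mul1r -big_split /=.
  by apply: eq_bigr => i _; rewrite /p liftK.
rewrite sumE.
case: eqP => [<-|mm'].
  rewrite mulrA divff ?multinomial_neq0 // mul1r big1 // => i _; rewrite cons_mnm_lift.
  by case: (wP i).
(* Otherwise each exponent of [m'] away from x_0 equals that of M_j or exceeds it by at least 2. The
   total degree leaves an excess of at most 1, so all agree and [m'] is [m]. *)
suff [i [lt_i|eq_i]] : exists i, (m' (lift ord0 i) < a j i)%N \/
    m' (lift ord0 i) = (a j i).+1.
- by rewrite (bigD1 i) //=; have [w0 _ _] := wP i; rewrite w0 // mul0r !mulr0.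
- by rewrite (bigD1 i) //= eq_i; have [_ _ ->] := wP i; rewrite mul0r !mulr0.
have [/existsP[i /orP[lt_i|/eqP eq_i]]|] := boolP [exists i : 'I_n,
    (m' (lift ord0 i) < a j i)%N || (m' (lift ord0 i) == (a j i).+1)].
- by exists i; left.
- by exists i; right.
rewrite negb_exists => /forallP no_i; exfalso.
have ge_a (i : 'I_n) : m' (lift ord0 i) = a j i \/ (a j i + 2 <= m' (lift ord0 i))%N.
  by have := no_i i; lia.
have le_a i : (a j i <= m' (lift ord0 i))%N by case: (ge_a i); lia.
have {}m'd : (m' ord0 + \sum_(i < n) m' (lift ord0 i) = 1 + \sum_(i < n) a j i)%N.
  by rewrite -(mdeg_cons_mnm 1) -m'd mdegE big_ord_recl.
have [all_eq|] := boolP [forall i : 'I_n, m' (lift ord0 i) == a j i].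
  apply: mm'; apply/mnmP => i.
  case: (unliftP ord0 i) => [k|] ->; rewrite ?cons_mnm_lift ?cons_mnm0.
    by have /eqP := forallP all_eq k.
  move: m'd; rewrite (eq_bigr (a j) (fun k _ => eqP (forallP all_eq k))).
  by move=> /addIn->.
rewrite negb_forall => /existsP[i neq_i].
have : (\sum_(k < n) a j k + 2 <= \sum_(k < n) m' (lift ord0 k))%N.
  rewrite (bigD1 i) // [leqRHS](bigD1 i) //= addnAC leq_add ?leq_sum //.
  by case: (ge_a i) => // eq_i; rewrite eq_i eqxx in neq_i.
by move: m'd; move: (\sum_(k < n) _)%N (\sum_(k < n) _)%N => x y; lia.
Qed.

Lemma simul_waring_rank_boxes (c : J -> K) :
  (forall j, c j != 0) ->
  (forall j i, (1 <= a j i < N)%N) -> one_one_free a ->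
  simul_waring_rank (fun j => c j *: x0_monomial K (a j)) =
  #|\bigcup_j box (a j)|.
Proof.
move=> c0 a_bnd a_free; apply: simul_waring_rank_eq; split=> [|r decomp].
  exact/simul_waring_decompZ/simul_waring_decomp_boxes.
apply: card_boxes_le_simul_waring_decomp.
have [L [L1 {}decomp]] :
    simul_waring_decomp (fun j => (c j)^-1 *: (c j *: x0_monomial K (a j))) r.
  by apply: simul_waring_decompZ decomp => j; rewrite invr_neq0.
exists L; split=> // j; have [lam] := decomp j.
by rewrite scalerA mulVf // scale1r; exists lam.
Qed.

End Boxes.

(** * Gcds of monomials and their ranks *)

Lemma mpolyX_factorization (K : fieldType) (n : nat) (u v : {mpoly K[n]}) m :
  u * v = 'X_[m] -> [/\ u != 0, v != 0 & (mlead u + mlead v)%MM = m].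
Proof.
move=> uvm.
have : u * v != 0 by rewrite uvm -msize_poly_eq0 msizeX.
rewrite mulf_eq0 negb_or => /andP[u0 v0]; split=> //.
by rewrite -mleadM // uvm mleadXm.
Qed.

(** The monomial of minima divides every member, hence the gcd, with a cofactor [c]. In each
    variable some member attains the minimum, so the leading exponent of [c] is zero and [c] is
    constant. *)
Lemma mpoly_gcd_x0_monomial (K : fieldType) (n : nat) (J : finType)
    (A : {set J}) (a : J -> 'I_n -> nat) (b : 'I_n -> nat) (g : {mpoly K[n.+1]}) :
  A != set0 ->
  (forall j i, j \in A -> (b i <= a j i)%N) ->
  (forall i, exists2 j, j \in A & a j i = b i) ->
  is_mpoly_gcd A (fun j => x0_monomial K (a j)) g ->
  exists2 c, c != 0 & g = c *: x0_monomial K b.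
Proof.
move=> /set0Pn[j0 j0A] b_le b_min [g_dvd g_max].
have [|c gE] := g_max (x0_monomial K b).
  move=> j jA; exists 'X_[cons_mnm 0 (fun i => a j i - b i)%N].
  rewrite !x0_monomialE -mpolyXD; congr 'X_[_]; apply/mnmP => i; rewrite mnmDE.
  case: (unliftP ord0 i) => [k|] ->; last by rewrite !cons_mnm0.
  by rewrite !cons_mnm_lift subnK // b_le.
have c_lead j : j \in A -> c != 0 /\
    exists m, (mlead c + m + cons_mnm 1 b)%MM = cons_mnm 1 (a j).
  move=> /g_dvd[q]; rewrite gE mulrCA x0_monomialE => /esym/mpolyX_factorization.
  move=> [c0]; rewrite mulf_eq0 negb_or => /andP[q0 b0] <-.
  split=> //; exists (mlead q).
  by rewrite mleadM // x0_monomialE mleadXm addmA.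
have c0 : c != 0 by case: (c_lead j0 j0A).
have lead0 : mlead c = 0%MM.
  apply/mnmP => i; rewrite mnm0E; case: (unliftP ord0 i) => [k|] ->.
    have [j jA ajk] := b_min k; have [_ [m /mnmP/(_ (lift ord0 k))]] := c_lead j jA.
    by rewrite !mnmDE !cons_mnm_lift ajk; lia.
  have [_ [m /mnmP/(_ ord0)]] := c_lead j0 j0A.
  by rewrite !mnmDE !cons_mnm0; lia.
have cE : c = (c@_0)%:MP.
  by apply: msize1_polyC; rewrite -mlead_deg // lead0 mdeg0.
exists c@_0; last by rewrite gE {1}cE mul_mpolyC.
by apply: contra c0 => /eqP c00; rewrite cE c00 mpolyC0.
Qed.

Lemma one_one_free_unit (n : nat) (b : 'I_n -> nat) :
  one_one_free (fun _ : unit => b).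
Proof.
move=> i; have -> : successive_differences [seq b i | _ <- enum (unit : finType)] = [::].
  apply/size0nil.
  by rewrite size_map size_iota size_sort size_map -cardE card_unit.
by [].
Qed.

Lemma exists_pointwise_min (n : nat) (J : finType) (A : {set J})
    (a : J -> 'I_n -> nat) :
  A != set0 -> exists b : 'I_n -> nat,
    (forall j i, j \in A -> (b i <= a j i)%N) /\
    (forall i, exists2 j, j \in A & a j i = b i).
Proof.
move=> /set0Pn[j0 j0A].
exists (fun i => a [arg min_(j < j0 in A) a j i]%N i); split=> [j i jA|i].
  by case: arg_minnP => // j1 _; apply.
by case: arg_minnP => // j jA _; exists j.
Qed.

(** The box of the pointwise minimum is the intersection of the boxes, and a single monomial is a
    (1,1)-free collection, so the box count gives its rank. *)
Lemma waring_rank_gcd (K : numFieldType) (n N : nat) (J : finType)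
    (A : {set J}) (a : J -> 'I_n -> nat) (g : {mpoly K[n.+1]}) :
  A != set0 -> (forall j i, (1 <= a j i < N)%N) ->
  is_mpoly_gcd A (fun j => x0_monomial K (a j)) g ->
  waring_rank g = #|\bigcap_(j in A) box N (a j)|.
Proof.
move=> A0 a_bnd g_gcd; have [b [b_le b_min]] := exists_pointwise_min a A0.
have [c c0 ->] := mpoly_gcd_x0_monomial A0 b_le b_min g_gcd.
rewrite /waring_rank (@simul_waring_rank_boxes K n N unit (fun=> b) (fun=> c)) //.
- rewrite (big_pred1 tt); last by case.
  congr #|pred_of_set _|; apply/setP => e; rewrite inE.
  apply/forallP/bigcapP => [eb j jA|eA i].
    by rewrite inE; apply/forallP => i; apply: leq_trans (eb i) (b_le j i jA).
  have [j jA <-] := b_min i.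
  by have := eA j jA; rewrite inE => /forallP.
- by move=> _ i; have [j _ <-] := b_min i.
exact: one_one_free_unit.
Qed.

Theorem corollary3p5 (R : realType) (n : nat) (J : finType)
    (J_nonempty : (0 < #|J|)%N)
    (a : J -> 'I_n -> nat)
    (a_ge1 : forall (j : J) (i : 'I_n), (1 <= a j i)%N)
    (M : J -> {mpoly R[i][n.+1]})
    (M_def : forall j : J, M j = x0_monomial R[i] (a j))
    (a_free : one_one_free a)
    (G : {set J} -> {mpoly R[i][n.+1]})
    (G_gcd : forall A : {set J}, A != set0 -> is_mpoly_gcd A M (G A)) :
  (simul_waring_rank M)%:Z =
  \sum_(A : {set J} | A != set0)
     (-1) ^+ (#|A|).+1 * (waring_rank (G A))%:Z :> int.
Proof.
(* Strictly above every exponent, since each is one summand. *)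
pose N := (\sum_j \sum_i a j i).+1.
have a_bnd j i : (1 <= a j i < N)%N.
  rewrite a_ge1 ltnS (bigD1 j) //= (bigD1 i) //= -addnA; apply: leq_addr.
have -> : M = (fun j => 1 *: x0_monomial R[i] (a j)).
  by apply: boolp.funext => j; rewrite scale1r.
rewrite (@simul_waring_rank_boxes _ _ N) // => [|j]; last exact: oner_neq0.
rewrite card_bigcup_inclusion_exclusion; apply: eq_bigr => A A0.
congr (_ * _%:Z); apply/esym/waring_rank_gcd => //.
have [G_dvd G_max] := G_gcd A A0; split=> [j jA|e e_dvd].
  by rewrite -M_def; apply: G_dvd.
by apply: G_max => j jA; rewrite M_def; apply: e_dvd.
Qed.
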